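(* Let $p=2$, let $a,c\in\mathbb{Q}_2$ with $ac\neq 0$ and $\sqrt{c^2-4a}\in\mathbb{Q}_2$, and let $f(x)=\frac{ax}{x^2+cx+a}$ for $x\in\mathbb{Q}_2\setminus\{\hat x_1,\hat x_2\}$, where $\hat x_{1,2}=\frac{-c\pm\sqrt{c^2-4a}}{2}$. Put $\alpha=\min\{|\hat x_1|_2,|\hat x_2|_2\}$, $\beta=\max\{|\hat x_1|_2,|\hat x_2|_2\}$. Let $r\in\{2^m:m\in\mathbb{Z}\}$ be such that the sphere $S_r(0)$ is invariant for $f$, and let $\mu$ be the normalized Haar measure on $S_r(0)$. Then the dynamical system $(S_r(0),f,\mu)$ is ergodic if and only if $|c|_2=\beta$ and $r=\frac{\alpha}{2}$.
   Context: $|\cdot|_2$ is the $2$-adic norm on $\mathbb{Q}_2$, and $S_r(0)=\{x\in\mathbb{Q}_2:|x|_2=r\}$. The sphere $S_r(0)$ is invariant for $f$ if for every $x\in S_r(0)$ all iterates $f^n(x)$, $n\ge1$, are defined and belong to $S_r(0)$. For a general prime $p$, the normalized Haar measure $\mu$ on a sphere $S_r(s)=\{x\in\mathbb{Q}_p:|x-s|_p=r\}$ is the probability measure on its Borel $\sigma$-algebra (generated by the balls contained in the sphere) determined by $\mu(V_\rho(t))=\frac{p\rho}{(p-1)r}$ for every ball $V_\rho(t)=\{x\in\mathbb{Q}_p:|x-t|_p\leq\rho\}\subset S_r(s)$, $\rho\in p^{\mathbb{Z}}$; here $p=2$. A measure-preserving transformation $T:X\to X$ of a probability space $(X,\Sigma,\mu)$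 is ergodic if for every $E\in\Sigma$ with $T^{-1}(E)=E$ either $\mu(E)=0$ or $\mu(E)=1$; on an invariant sphere, $f$ preserves $\mu$. *)

(* Defs.v *)
From HB Require Import structures.
From mathcomp Require Import all_boot all_order all_algebra.
From mathcomp Require Import ring_quotient generic_quotient.
From mathcomp Require Import ring lra.
From mathcomp Require Import all_classical all_reals all_analysis.

Set Implicit Arguments.
Unset Strict Implicit.
Unset Printing Implicit Defensive.

Import Order.TTheory GRing.Theory Num.Theory.

Local Open Scope classical_set_scope.
Local Open Scope ring_scope.
Local Open Scope quotient_scope.

(* The p-adic valuation of x is logn p `|numq x| - logn p `|denq x|. *)
Definition ratpnorm (p : nat) (x : rat) : rat :=
  if x == 0 then 0
  else p%:R ^ ((logn p `|denq x|)%:Z - (logn p `|numq x|)%:Z).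

Section RatNorm.
Variables (p : nat) (p_pr : prime p).
Local Notation nrm := (ratpnorm p).

Let p_gt0 : (0 : rat) < p%:R. Proof. by rewrite ltr0n prime_gt0. Qed.
Let p_neq0 : (p%:R : rat) != 0. Proof. by rewrite gt_eqF. Qed.
Let p_gt1 : (1 : rat) < p%:R. Proof. by rewrite ltr1n prime_gt1. Qed.

Lemma ratpnorm0 : nrm 0 = 0. Proof. by rewrite /ratpnorm eqxx. Qed.

Lemma ratpnorm_gt0 x : (0 < nrm x) = (x != 0).
Proof.
rewrite /ratpnorm; case: eqP => [_|_] /=; first by rewrite ltxx.
by rewrite exprz_gt0.
Qed.

Lemma ratpnorm_ge0 x : 0 <= nrm x.
Proof.
by have [->|x0] := eqVneq x 0; rewrite ?ratpnorm0 // ltW // ratpnorm_gt0.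
Qed.

Lemma ratpnorm_eq0 x : (nrm x == 0) = (x == 0).
Proof.
have [->|x0] := eqVneq x 0; first by rewrite ratpnorm0 eqxx.
by rewrite gt_eqF // ratpnorm_gt0.
Qed.

Lemma ratpnorm_frac (a b : int) : a != 0 -> b != 0 ->
  nrm (a%:~R / b%:~R) = p%:R ^ ((logn p `|b|)%:Z - (logn p `|a|)%:Z).
Proof.
move=> a0 b0; set x : rat := _ / _.
have x0 : x != 0 by rewrite mulf_neq0 ?invr_eq0 ?intr_eq0.
have xb : x * b%:~R = a%:~R by rewrite /x divfK ?intr_eq0.
have E : numq x * b = a * denq x.
  by apply: (@intr_inj rat); rewrite !intrM numqE mulrAC xb.
have /(congr1 absz) := E; rewrite !abszM => /(congr1 (logn p)).
rewrite !lognM ?absz_gt0 ?denq_neq0 ?numq_eq0 // => EL.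
rewrite /ratpnorm (negbTE x0); congr (_ ^ _).
by apply/eqP; rewrite subr_eq addrAC eq_sym subr_eq -!PoszD addnC EL addnC.
Qed.

Lemma ratpnormM : {morph nrm : x y / x * y}.
Proof.
move=> x y; have [->|x0] := eqVneq x 0; first by rewrite mul0r ratpnorm0 mul0r.
have [->|y0] := eqVneq y 0; first by rewrite mulr0 ratpnorm0 mulr0.
have -> : x * y = (numq x * numq y)%:~R / (denq x * denq y)%:~R.
  rewrite -{1}[x]divq_num_den -{1}[y]divq_num_den !intrM invfM; ring.
rewrite ratpnorm_frac ?mulf_neq0 ?denq_neq0 ?numq_eq0 // !abszM.
rewrite !lognM ?absz_gt0 ?denq_neq0 ?numq_eq0 //.
rewrite /ratpnorm (negbTE x0) (negbTE y0) -expfzDr //; congr (_ ^ _).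
by rewrite !PoszD; ring.
Qed.

Lemma ratpnormN x : nrm (- x) = nrm x.
Proof.
by rewrite /ratpnorm oppr_eq0 numqN denqN; case: ifP => // _; rewrite abszN.
Qed.

Lemma ratpnormB x y : nrm (x - y) = nrm (y - x).
Proof. by rewrite -ratpnormN opprB. Qed.

Lemma ratpnorm1 : nrm 1 = 1.
Proof. by rewrite /ratpnorm oner_eq0 /= logn1. Qed.

Lemma ratpnormD x y : nrm (x + y) <= Num.max (nrm x) (nrm y).
Proof.
have [->|x0] := eqVneq x 0; first by rewrite add0r le_max lexx orbT.
have [->|y0] := eqVneq y 0; first by rewrite addr0 le_max lexx.
have [->|xy0] := eqVneq (x + y) 0.
  by rewrite ratpnorm0 le_max ratpnorm_ge0.
have d0 : denq x * denq y != 0 by rewrite mulf_neq0 ?denq_neq0.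
have dx0 : (denq x)%:~R != 0 :> rat by rewrite intr_eq0 denq_neq0.
have dy0 : (denq y)%:~R != 0 :> rat by rewrite intr_eq0 denq_neq0.
set d : int := denq x * denq y in d0; pose a : int := numq x * denq y.
pose b : int := numq y * denq x.
have Ex : x = a%:~R / d%:~R.
  by rewrite -{1}[x]divq_num_den !intrM; field; rewrite dx0 dy0.
have Ey : y = b%:~R / d%:~R.
  by rewrite -{1}[y]divq_num_den !intrM; field; rewrite dx0 dy0.
have a0 : a != 0 by rewrite mulf_neq0 ?denq_neq0 ?numq_eq0.
have b0 : b != 0 by rewrite mulf_neq0 ?denq_neq0 ?numq_eq0.
have Exy : x + y = (a + b)%:~R / d%:~R by rewrite Ex Ey intrD mulrDl.
have ab0 : a + b != 0.
  by apply: contraNneq xy0 => e; rewrite Exy e mul0r.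
rewrite Exy Ex Ey !ratpnorm_frac // le_max !ler_eXz2l // !lerD2l !lerN2.
rewrite !lez_nat.
rewrite -geq_min -pfactor_dvdn ?absz_gt0 //.
have D k : (k <= logn p `|a|%N)%N -> (k <= logn p `|b|%N)%N ->
    (p ^ k %| `|(a + b)%R|)%N.
  rewrite -!pfactor_dvdn ?absz_gt0 // => ka kb.
  have : ((p ^ k)%:Z %| a + b)%Z by rewrite rpredD // dvdzE.
  by rewrite dvdzE.
by apply: D; rewrite ?geq_minl ?geq_minr.
Qed.

Lemma ratpnorm_add_max x y z e : nrm (x - y) <= e -> nrm (y - z) <= e ->
  nrm (x - z) <= e.
Proof.
move=> h1 h2; rewrite -(subrKA y); apply: le_trans (ratpnormD _ _) _.
by rewrite ge_max h1 h2.
Qed.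

Lemma ratpnormD_eq x y : nrm x < nrm y -> nrm (x + y) = nrm y.
Proof.
move=> xy; apply/eqP; rewrite eq_le; apply/andP; split.
  by apply: le_trans (ratpnormD _ _) _; rewrite ge_max lexx ltW.
have := ratpnormD (- x) (x + y); rewrite addKr ratpnormN le_max.
by rewrite leNgt xy.
Qed.

Lemma ratpnormV x : nrm x^-1 = (nrm x)^-1.
Proof.
have [->|x0] := eqVneq x 0; first by rewrite !(invr0, ratpnorm0).
have n0 : nrm x != 0 by rewrite ratpnorm_eq0.
by apply: (mulfI n0); rewrite -ratpnormM !mulfV // ratpnorm1.
Qed.

End RatNorm.

(* Q_p is built as the completion of rat: Cauchy sequences for the p-adic
   absolute value, modulo null sequences. The proof of primality is a parameter
   because the quotient is a field only for prime p. *)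
Section CauchySequences.
Variables (p : nat) (p_pr : prime p).
Local Notation nrm := (ratpnorm p).

Definition is_pcauchy (u : nat -> rat) : Prop :=
  forall e : rat, 0 < e ->
    exists N, forall m n, (N <= m)%N -> (N <= n)%N -> nrm (u m - u n) < e.

(* The unused proof of primality lets the subring instance below be inferred. *)
Definition pcauchy_pred (_ : prime p) : {pred nat -> rat} :=
  fun u => `[< is_pcauchy u >].

Lemma pcauchyP u : reflect (is_pcauchy u) (u \in pcauchy_pred p_pr).
Proof. exact: asboolP. Qed.

Lemma is_pcauchy_bounded u : is_pcauchy u ->
  exists2 B : rat, 0 < B & forall n, nrm (u n) <= B.
Proof.
move=> /(_ 1 ltr01) [N hN].
have [B B0 hB] : exists2 B : rat, 0 < B &
    forall n, (n <= N)%N -> nrm (u n) <= B.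
  elim: N {hN} => [|N [B B0 hB]].
    exists (nrm (u 0%N) + 1) => [|n]; first by rewrite ltr_wpDl // ratpnorm_ge0.
    by rewrite leqn0 => /eqP ->; rewrite lerDl.
  exists (Num.max B (nrm (u N.+1))); first by rewrite lt_max B0.
  move=> n; rewrite leq_eqVlt ltnS => /orP[/eqP ->|/hB h].
    by rewrite le_max lexx orbT.
  by rewrite le_max h.
exists (Num.max B 1) => [|n]; first by rewrite lt_max B0.
have [nN|Nn] := leqP n N; first by rewrite le_max hB.
rewrite -[u n](subrK (u N)); apply: le_trans (ratpnormD p_pr _ _) _.
rewrite ge_max !le_max (hB N) //= andbT.
by rewrite (ltW (hN _ _ (ltnW Nn) (leqnn N))) orbT.
Qed.

Lemma pcauchy_subring : subring_closed (pcauchy_pred p_pr).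
Proof.
split.
- by apply/pcauchyP => e e0; exists 0%N => m n _ _; rewrite subrr ratpnorm0.
- move=> u v /pcauchyP hu /pcauchyP hv; apply/pcauchyP => e e0.
  have [N hN] := hu e e0; have [M hM] := hv e e0.
  exists (maxn N M) => m n; rewrite !geq_max => /andP[Nm Mm] /andP[Nn Mn].
  have -> : (u - v) m - (u - v) n = (u m - u n) + (v n - v m).
    by rewrite /= !fctE; ring.
  apply: le_lt_trans (ratpnormD p_pr _ _) _.
  by rewrite gt_max hN // hM.
- move=> u v /pcauchyP hu /pcauchyP hv; apply/pcauchyP => e e0.
  have [B B0 hB] := is_pcauchy_bounded hu.
  have [C C0 hC] := is_pcauchy_bounded hv.
  have [N hN] := hu _ (divr_gt0 e0 C0); have [M hM] := hv _ (divr_gt0 e0 B0).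
  exists (maxn N M) => m n; rewrite !geq_max => /andP[Nm Mm] /andP[Nn Mn].
  have -> : (u * v) m - (u * v) n = (u m - u n) * v m + u n * (v m - v n).
    by rewrite /= !fctE; ring.
  apply: le_lt_trans (ratpnormD p_pr _ _) _.
  rewrite gt_max !(ratpnormM p_pr); apply/andP; split.
    have := hN _ _ Nm Nn; rewrite ltr_pdivlMr //; apply: le_lt_trans.
    by rewrite ler_wpM2l ?ratpnorm_ge0.
  have := hM _ _ Mm Mn; rewrite ltr_pdivlMr // mulrC; apply: le_lt_trans.
  by rewrite ler_wpM2r ?ratpnorm_ge0.
Qed.

HB.instance Definition _ :=
  GRing.isSubringClosed.Build _ (pcauchy_pred p_pr) pcauchy_subring.

Record pcauchy := PCauchy {
  pcauchy_val :> nat -> rat;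
  pcauchy_valP : pcauchy_val \in pcauchy_pred p_pr }.

HB.instance Definition _ := [isSub for pcauchy_val].
HB.instance Definition _ := [Choice of pcauchy by <:].
HB.instance Definition _ := [SubChoice_isSubComNzRing of pcauchy by <:].

Definition is_pnull (u : nat -> rat) : Prop :=
  forall e : rat, 0 < e -> exists N, forall n, (N <= n)%N -> nrm (u n) < e.

Definition pnull : {pred pcauchy} := fun u => `[< is_pnull u >].

Lemma pnull_idealr : idealr_closed pnull.
Proof.
split.
- by apply/asboolP => e e0; exists 0%N => n _; rewrite ratpnorm0.
- apply/asboolP => /(_ 1 ltr01) [N /(_ N (leqnn N))].
  by rewrite (ratpnorm1 p) ltxx.
- move=> a u v /asboolP hu /asboolP hv; apply/asboolP => e e0.
  have [B B0 hB] := is_pcauchy_bounded (pcauchyP _ (pcauchy_valP a)).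
  have [N hN] := hu _ (divr_gt0 e0 B0); have [M hM] := hv e e0.
  exists (maxn N M) => n; rewrite geq_max => /andP[Nn Mn].
  apply: le_lt_trans (ratpnormD p_pr _ _) _.
  rewrite gt_max (hM _ Mn) andbT (ratpnormM p_pr).
  have := hN _ Nn; rewrite ltr_pdivlMr // mulrC; apply: le_lt_trans.
  by rewrite ler_wpM2r ?ratpnorm_ge0.
Qed.

HB.instance Definition _ := isIdealr.Build _ pnull pnull_idealr.


Definition padic : Type := {ideal_quot pnull}.

HB.instance Definition _ := GRing.ComNzRing.on padic.
HB.instance Definition _ := NzRingQuotient.on padic.

Lemma padic_pi_eq0 (u : pcauchy) : (\pi_padic u == 0) = (u \in pnull).
Proof. by rewrite -(rmorph0 \pi_padic) piE /= Quotient.equivE subr0. Qed.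

(* |x|_p is the limit of |u_n|_p for any sequence u representing x. *)
Definition is_norm_lim (u : nat -> rat) (v : rat) : Prop :=
  forall e : rat, 0 < e ->
    exists N, forall n, (N <= n)%N -> `|nrm (u n) - v| < e.

Definition pnorm (x : padic) : rat :=
  xget 0 [set v | is_norm_lim (repr x : pcauchy) v].

Lemma pcauchy_stable (u : pcauchy) : u \notin pnull ->
  exists2 v, 0 < v & exists N, forall n, (N <= n)%N -> nrm (u n) = v.
Proof.
move=> /asboolPn /existsNP[e] /not_implyP[e0] /forallNP hu.
have [N hN] := pcauchyP _ (pcauchy_valP u) e e0.
have /existsNP[k /not_implyP[Nk /negP]] := hu N; rewrite -leNgt => hk.
exists (nrm (u k)); first exact: lt_le_trans hk.
exists N => n Nn; rewrite -[u n](subrK (u k)) ratpnormD_eq //.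
by apply: lt_le_trans hk; apply: hN.
Qed.

Lemma is_norm_lim_unique u v w : is_norm_lim u v -> is_norm_lim u w -> v = w.
Proof.
move=> hv hw; apply/eqP/negP => /negP vw.
have e0 : 0 < `|v - w| / 2 by rewrite divr_gt0 // normr_gt0 subr_eq0.
have [N hN] := hv _ e0; have [M hM] := hw _ e0.
have := hN _ (leq_maxl N M); have := hM _ (leq_maxr N M).
move: (nrm _) => t tw tv; have : `|v - w| < `|v - w|.
  have {1}-> : v - w = (t - w) - (t - v) by ring.
  apply: le_lt_trans (ler_normB _ _) _.
  by rewrite [ltRHS]splitr ltrD.
by rewrite ltxx.
Qed.

Lemma norm_ratpnormB x y : `|nrm x - nrm y| <= nrm (x - y).
Proof.
wlog: x y / nrm x <= nrm y => [H|xy].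
  have /orP[|xy] := le_total (nrm x) (nrm y); first exact: H.
  by rewrite distrC ratpnormB H.
rewrite distrC ger0_norm ?subr_ge0 //; move: xy; rewrite le_eqVlt.
move=> /orP[/eqP ->|xy]; first by rewrite subrr ratpnorm_ge0.
rewrite -ratpnormB -[y - x]addrC ratpnormD_eq ?ratpnormN //.
by rewrite gerBl ratpnorm_ge0.
Qed.

Lemma pnorm_pi (u : pcauchy) v : is_norm_lim u v -> pnorm (\pi_padic u) = v.
Proof.
move=> hv; suff h : is_norm_lim (repr (\pi_padic u) : pcauchy) v.
  apply: xget_subset1 => // w w' /=; exact: is_norm_lim_unique.
set u' : pcauchy := repr _.
have /asboolP hn : u' - u \in pnull.
  by rewrite -padic_pi_eq0 rmorphB /= /u' reprK subrr.
move=> e e0; have e20 : 0 < e / 2 by rewrite divr_gt0.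
have [N hN] := hv _ e20; have [M hM] := hn _ e20.
exists (maxn N M) => n; rewrite geq_max => /andP[Nn Mn].
rewrite -(subrKA (nrm (u n))); apply: le_lt_trans (ler_normD _ _) _.
rewrite [ltRHS]splitr ltrD ?hN //; apply: le_lt_trans (norm_ratpnormB _ _) _.
exact: hM.
Qed.

Lemma is_norm_lim_stable (u : nat -> rat) v N :
  (forall n, (N <= n)%N -> nrm (u n) = v) -> is_norm_lim u v.
Proof. by move=> h e e0; exists N => n /h ->; rewrite subrr normr0. Qed.

Lemma pnorm0 : pnorm 0 = 0.
Proof.
rewrite -(rmorph0 \pi_padic); apply: pnorm_pi.
by apply: (@is_norm_lim_stable _ _ 0%N) => n _; rewrite ratpnorm0.
Qed.

Lemma padic_stable (x : padic) : x != 0 ->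
  exists2 u : pcauchy, x = \pi_padic u &
  0 < pnorm x /\ exists N, forall n, (N <= n)%N -> nrm (u n) = pnorm x.
Proof.
move=> x0; exists (repr x : pcauchy); first by rewrite reprK.
have [|v v0 [N hN]] := @pcauchy_stable (repr x).
  by rewrite -padic_pi_eq0 reprK.
suff -> : pnorm x = v by split => //; exists N.
rewrite -[x]reprK; apply: pnorm_pi; exact: is_norm_lim_stable hN.
Qed.

Lemma padic_inv_ex (x : padic) : x != 0 -> exists y, y * x = 1.
Proof.
move=> x0; have [u xE [c0 [N hN]]] := padic_stable x0.
move: (pnorm x) c0 hN => c c0 hN; rewrite {x x0}xE.
have hu n : (N <= n)%N -> u n != 0.
  by move=> Nn; rewrite -(ratpnorm_gt0 p_pr) hN.
have cw : (fun n => (u n)^-1) \in pcauchy_pred p_pr.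
  apply/pcauchyP => e e0.
  have ec0 : 0 < e * c ^+ 2 by rewrite mulr_gt0 ?exprn_gt0.
  have [M hM] := pcauchyP _ (pcauchy_valP u) _ ec0.
  exists (maxn N M) => m n; rewrite !geq_max => /andP[Nm Mm] /andP[Nn Mn].
  have -> : (u m)^-1 - (u n)^-1 = (u n - u m) * ((u m)^-1 * (u n)^-1).
    by field; rewrite !hu.
  rewrite !(ratpnormM p_pr) !(ratpnormV p_pr) !hN // -invfM -expr2.
  by rewrite ltr_pdivrMr ?exprn_gt0 // hM.
exists (\pi_padic (PCauchy cw)); rewrite -rmorphM /=.
apply/eqP; rewrite -subr_eq0 -(rmorph1 \pi_padic) -rmorphB /= padic_pi_eq0.
apply/asboolP => e e0; exists N => n Nn.
have -> : (PCauchy cw * u - 1 : pcauchy) n = (u n)^-1 * u n - 1 by [].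
by rewrite mulVf ?hu // subrr ratpnorm0.
Qed.

Definition padic_inv (x : padic) : padic :=
  if x == 0 then 0 else xget 0 [set y | y * x = 1].

Lemma padic_mulVf (x : padic) : x != 0 -> padic_inv x * x = 1.
Proof.
move=> x0; rewrite /padic_inv (negbTE x0); have [y yx] := padic_inv_ex x0.
by case: xgetP => [z _ //|/(_ y)].
Qed.

Lemma padic_inv0 : padic_inv 0 = 0. Proof. by rewrite /padic_inv eqxx. Qed.

HB.instance Definition _ :=
  GRing.ComNzRing_isField.Build padic padic_mulVf padic_inv0.

Lemma pnorm_gt0 (x : padic) : (0 < pnorm x) = (x != 0).
Proof.
have [->|x0] := eqVneq x 0; first by rewrite pnorm0 ltxx.
by have [? _ []] := padic_stable x0.
Qed.

Lemma pnorm_ge0 (x : padic) : 0 <= pnorm x.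
Proof.
by have [->|x0] := eqVneq x 0; rewrite ?pnorm0 // ltW // pnorm_gt0.
Qed.

Lemma pnorm_eq0 (x : padic) : (pnorm x == 0) = (x == 0).
Proof.
have [->|x0] := eqVneq x 0; first by rewrite pnorm0 eqxx.
by rewrite gt_eqF // pnorm_gt0.
Qed.

Lemma pnormM (x y : padic) : pnorm (x * y) = pnorm x * pnorm y.
Proof.
have [->|x0] := eqVneq x 0; first by rewrite !(mul0r, pnorm0).
have [->|y0] := eqVneq y 0; first by rewrite !(mulr0, pnorm0).
have [u xE [_ [N hN]]] := padic_stable x0.
have [v yE [_ [M hM]]] := padic_stable y0.
rewrite {1}xE {1}yE -rmorphM; apply: pnorm_pi.
apply: (@is_norm_lim_stable _ _ (maxn N M)) => n.
by rewrite geq_max => /andP[/hN <- /hM <-]; rewrite -(ratpnormM p_pr).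
Qed.

Lemma pnormD (x y : padic) : pnorm (x + y) <= Num.max (pnorm x) (pnorm y).
Proof.
have [->|x0] := eqVneq x 0; first by rewrite add0r le_max lexx orbT.
have [->|y0] := eqVneq y 0; first by rewrite addr0 le_max lexx.
have [->|xy0] := eqVneq (x + y) 0; first by rewrite pnorm0 le_max pnorm_ge0.
have [u xE [_ [N hN]]] := padic_stable x0.
have [v yE [_ [M hM]]] := padic_stable y0.
have [w xyE [_ [K hK]]] := padic_stable xy0.
have [|c c0 [L hL]] := @pcauchy_stable (u + v).
  by rewrite -padic_pi_eq0 rmorphD /= -xE -yE.
have -> : pnorm (x + y) = c.
  rewrite {1}xE {1}yE -rmorphD; apply: pnorm_pi; exact: is_norm_lim_stable hL.
pose n := (maxn L (maxn N M)).
rewrite -(hL n) ?leq_maxl // -(hN n) -1?(hM n) ?ratpnormD //;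
  by rewrite /n !leq_max leqnn !orbT.
Qed.

Let const_cauchy (q : rat) : (fun _ => q) \in pcauchy_pred p_pr.
Proof.
by apply/pcauchyP => e e0; exists 0%N => m n _ _; rewrite subrr ratpnorm0.
Qed.

Let of_rat (q : rat) : padic := \pi_padic (PCauchy (const_cauchy q)).

Let of_rat_zmod : zmod_morphism of_rat.
Proof.
by move=> x y; rewrite /of_rat -rmorphB; congr (\pi_padic _); apply/val_inj.
Qed.

Let of_rat_monoid : monoid_morphism of_rat.
Proof.
split=> [|x y].
  by rewrite -(rmorph1 \pi_padic); congr (\pi_padic _); apply/val_inj.
by rewrite /of_rat -rmorphM; congr (\pi_padic _); apply/val_inj.
Qed.

#[local] HB.instance Definition _ :=
  GRing.isZmodMorphism.Build rat padic of_rat of_rat_zmod.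
#[local] HB.instance Definition _ :=
  GRing.isMonoidMorphism.Build rat padic of_rat of_rat_monoid.

Let of_ratE : of_rat =1 ratr. Proof. exact: fmorph_eq_rat. Qed.

Lemma pnorm_rat (q : rat) : pnorm (ratr q) = nrm q.
Proof.
rewrite -of_ratE; apply: pnorm_pi.
by apply: (@is_norm_lim_stable _ _ 0%N).
Qed.

Lemma pnormN (x : padic) : pnorm (- x) = pnorm x.
Proof.
rewrite -mulN1r pnormM -[RHS]mul1r; congr (_ * _).
have -> : -1 = ratr (-1) :> padic by rewrite -of_ratE rmorphN rmorph1.
by rewrite pnorm_rat ratpnormN ratpnorm1.
Qed.

Lemma padic_dense (x : padic) (e : rat) : 0 < e ->
  exists q : rat, pnorm (x - ratr q) < e.
Proof.
move=> e0; have e20 : 0 < e / 2 by rewrite divr_gt0.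
have [N hN] := pcauchyP _ (pcauchy_valP (repr x : pcauchy)) _ e20.
exists ((repr x : pcauchy) N); set q := _ N.
have [->|xq0] := eqVneq (x - ratr q) 0; first by rewrite pnorm0.
pose w : pcauchy := (repr x : pcauchy) - PCauchy (const_cauchy q).
have xqE : x - ratr q = \pi_padic w.
  by rewrite /w rmorphB /= reprK -of_ratE.
have [|c c0 [M hM]] := @pcauchy_stable w; first by rewrite -padic_pi_eq0 -xqE.
have -> : pnorm (x - ratr q) = c.
  by rewrite xqE; apply: pnorm_pi; apply: is_norm_lim_stable hM.
rewrite -(hM (maxn M N)) ?leq_maxl //.
apply: lt_trans (_ : e / 2 < e); first exact: (hN _ _ (leq_maxr _ _) (leqnn N)).
by rewrite ltr_pdivrMr // ltr_pMr // ltr1n.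
Qed.

Lemma padic_complete (x : nat -> padic) :
  (forall e : rat, 0 < e -> exists N, forall m n, (N <= m)%N -> (N <= n)%N ->
     pnorm (x m - x n) < e) ->
  exists y : padic, forall e : rat, 0 < e -> exists N, forall n, (N <= n)%N ->
     pnorm (x n - y) < e.
Proof.
move=> hx; pose d (n : nat) : rat := n.+1%:R^-1.
have d0 n : 0 < d n by rewrite invr_gt0 ltr0n.
have dlim e : 0 < e -> exists N, forall n, (N <= n)%N -> d n < e.
  move=> e0; exists (Num.truncn e^-1) => n Nn.
  rewrite invf_plt ?posrE ?ltr0n //; apply: lt_le_trans (truncnS_gt _) _.
  by rewrite ler_nat.
have /choice[q hq] n : exists q : rat, pnorm (x n - ratr q) < d n.
  exact: padic_dense.
have cq : q \in pcauchy_pred p_pr.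
  apply/pcauchyP => e e0; have [N hN] := hx e e0; have [M hM] := dlim e e0.
  exists (maxn N M) => m n; rewrite !geq_max => /andP[Nm Mm] /andP[Nn Mn].
  rewrite -pnorm_rat.
  have -> : ratr (q m - q n) = (x m - x n) - (x m - ratr (q m)) +
     (x n - ratr (q n)) :> padic by rewrite -!of_ratE rmorphB; ring.
  apply: le_lt_trans (pnormD _ _) _; rewrite gt_max (lt_trans (hq n)) ?hM //.
  rewrite andbT; apply: le_lt_trans (pnormD _ _) _; rewrite gt_max pnormN.
  by rewrite hN // (lt_trans (hq m)) ?hM.
exists (\pi_padic (PCauchy cq)) => e e0.
have e20 : 0 < e / 2 by rewrite divr_gt0.
have e2e : e / 2 < e by rewrite ltr_pdivrMr // ltr_pMr // ltr1n.
have [N hN] := pcauchyP _ cq _ e20; have [M hM] := dlim e e0.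
exists (maxn N M) => n; rewrite geq_max => /andP[Nn Mn].
rewrite -(subrKA (ratr (q n))); apply: le_lt_trans (pnormD _ _) _.
rewrite gt_max (lt_trans (hq n)) ?hM //=.
have [->|z0] := eqVneq (ratr (q n) - \pi_padic (PCauchy cq)) 0.
  by rewrite pnorm0.
pose w : pcauchy := PCauchy (const_cauchy (q n)) - PCauchy cq.
have zE : ratr (q n) - \pi_padic (PCauchy cq) = \pi_padic w.
  by rewrite /w rmorphB /= -of_ratE.
have [|c c0 [K hK]] := @pcauchy_stable w; first by rewrite -padic_pi_eq0 -zE.
rewrite zE (pnorm_pi (is_norm_lim_stable hK)) -(hK (maxn K N)) ?leq_maxl //.
by apply: lt_trans e2e; apply: hN; rewrite ?leq_maxr.
Qed.

End CauchySequences.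

Definition prime2 : prime 2 := isT.
Notation Q_2 := (padic prime2).

Section Spheres.
Variables (p : nat) (p_pr : prime p).
Local Notation Q_p := (padic p_pr).

Definition pball (t : Q_p) (rho : rat) : set Q_p :=
  [set x | pnorm (x - t) <= rho].

Definition psphere (s : Q_p) (r : rat) : set Q_p :=
  [set x | pnorm (x - s) = r].

Lemma psphere_nonempty s (m : int) :
  s + ratr (p%:R ^ (- m)) \in psphere s (p%:R ^ m).
Proof.
rewrite inE /psphere /= addrC addKr pnorm_rat.
have p0 : (p%:R : rat) != 0 by rewrite pnatr_eq0 -lt0n prime_gt0.
have np : ratpnorm p p%:R = p%:R^-1.
  have := @ratpnorm_frac p p%:Z 1; rewrite /= divr1 logn1 sub0r => -> //.
    by rewrite /= logn_prime // eqxx exprN1.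
  by rewrite -lt0n prime_gt0.
have nX k : ratpnorm p (p%:R ^+ k) = p%:R^-1 ^+ k.
  elim: k => [|k IH]; first by rewrite ratpnorm1.
  by rewrite !exprS (ratpnormM p_pr) IH np.
case: m => k; last first.
  by rewrite NegzE opprK -exprnP nX exprVn.
by rewrite -invr_expz -exprnP (ratpnormV p_pr) nX exprVn invrK.
Qed.

(* Spheres with radius in p^Z are indexed by the exponent of the radius: they
   are nonempty, as measurable types must be pointed. *)
Variables (s : Q_p) (m : int).

Definition psphere_type : Type := set_type (psphere s (p%:R ^ m)).
HB.instance Definition _ := Choice.on psphere_type.
HB.instance Definition _ :=
  isPointed.Build psphere_type (SigSub (psphere_nonempty s m)).

Definition psphere_balls : set (set psphere_type) :=
  [set E | exists (t : Q_p) (k : int),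
     pball t (p%:R ^ k) `<=` psphere s (p%:R ^ m) /\
     E = (fun x : psphere_type => val x) @^-1` pball t (p%:R ^ k)].

Definition psphere_space := g_sigma_algebraType psphere_balls.
HB.instance Definition _ := Measurable.on psphere_space.

Definition is_normalized_haar (R : realType)
    (mu : probability psphere_space R) : Prop :=
  forall (t : Q_p) (k : int), pball t (p%:R ^ k) `<=` psphere s (p%:R ^ m) ->
    mu ((fun x : psphere_space => val (x : psphere_type))
          @^-1` pball t (p%:R ^ k)) =
    (ratr ((p%:R * p%:R ^ k) / ((p%:R - 1) * p%:R ^ m)))%:E.

End Spheres.

(* D is the domain of definition of the partial map represented by the total
   function f, so that the n-th iterate is defined at x when D contains the
   first n points of the orbit. *)
Definition invariant_set (T : Type) (D : set T) (f : T -> T) (S : set T) :=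
  forall x, S x -> forall n, (0 < n)%N ->
    (forall k, (k < n)%N -> D (iter k f x)) /\ S (iter n f x).

Lemma invariant_set_mem (T : Type) (D S : set T) (f : T -> T) :
  invariant_set D f S -> forall x, x \in S -> f x \in S.
Proof. by move=> h x; rewrite !inE => /h /(_ 1%N isT) []. Qed.

Definition psphere_map (p : nat) (p_pr : prime p) (s : padic p_pr) (m : int)
    (D : set (padic p_pr)) (f : padic p_pr -> padic p_pr)
    (h : invariant_set D f (psphere s (p%:R ^ m))) :
    psphere_space s m -> psphere_space s m :=
  fun x => SigSub (invariant_set_mem h (svalP x)).

Definition measure_preserving d (X : measurableType d) (R : realType)
    (mu : {measure set X -> \bar R}) (T : X -> X) : Prop :=
  measurable_fun [set: X] T /\
  forall E, measurable E -> mu (T @^-1` E) = mu E.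

Definition ergodic d (X : measurableType d) (R : realType)
    (mu : probability X R) (T : X -> X) : Prop :=
  measure_preserving mu T /\
  forall E, measurable E -> T @^-1` E = E -> mu E = 0%E \/ mu E = 1%E.

(* Main.v *)
Require Import Defs.
From HB Require Import structures.
From mathcomp Require Import all_boot all_order all_algebra.
From mathcomp Require Import ring lra zify.
From mathcomp Require Import all_classical all_reals all_analysis.

Set Implicit Arguments.
Unset Strict Implicit.
Unset Printing Implicit Defensive.

Import Order.TTheory GRing.Theory Num.Theory.
Local Open Scope classical_set_scope.
Local Open Scope ring_scope.

(** Write [x1], [x2] for the poles, so that [a = x1 * x2], [c = - (x1 + x2)] and
    [f x = a x / ((x - x1) (x - x2))].

    On an invariant sphere of radius [r] the ultrametric inequality forces
    [r < alpha] ([invariant_radius_lt]); then the denominator has constant norm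
    [|a| = alpha beta] and [|f x - x| = r^2 |c + x| / |a|] ([map_step_norm]).
    Since the residue field has two elements, two 2-adic numbers of equal norm
    add up to something at most half as large ([pnormD_half]); hence
    [|c| = beta] exactly when [alpha < beta].

    If the condition fails, these estimates give [|f x - x| <= r / 4] on the
    whole sphere: every ball of radius [r / 4] is invariant, and it has measure
    1/2, so [f] is not ergodic ([small_step_not_ergodic]).

    If the condition holds, then [|f x - x| = r / 2] for all [x], and the
    displacement [f x - x] is Lipschitz with constant 1/4 ([map_rigid]).  Any
    such map behaves like the 2-adic translation by 1 (the adding machine): by
    doubling, its iterate of order [2 ^ k] moves every point by exactly
    [r / 2 ^ (k + 1)] ([iter_displacement]), so that its orbits visit every ball
    ([iter_transitive]).  Being an isometry it permutes the balls of each
    radius, which gives invariance of the Haar measure.  An invariant set [E]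
    meets all balls of a given radius in the same measure, so it is independent
    of every ball, hence of every measurable set and of itself:
    [mu E = mu E ^ 2] ([adding_machine_ergodic]). *)

(** * The p-adic absolute value *)

Section PadicNorm.
Variables (p : nat) (p_pr : prime p).
Implicit Types x y : padic p_pr.

Lemma pnorm1 : pnorm (1 : padic p_pr) = 1.
Proof.
have n0 : pnorm (1 : padic p_pr) != 0 by rewrite pnorm_eq0 oner_eq0.
by apply: (mulfI n0); rewrite -pnormM !mulr1.
Qed.

Lemma pnormV x : pnorm x^-1 = (pnorm x)^-1.
Proof.
have [->|x0] := eqVneq x 0; first by rewrite invr0 pnorm0 invr0.
have n0 : pnorm x != 0 by rewrite pnorm_eq0.
by apply: (mulfI n0); rewrite -pnormM !mulfV // pnorm1.
Qed.

Lemma pnorm_div x y : pnorm (x / y) = pnorm x / pnorm y.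
Proof. by rewrite pnormM pnormV. Qed.

Lemma pnormX x n : pnorm (x ^+ n) = pnorm x ^+ n.
Proof.
elim: n => [|n IH]; first by rewrite !expr0 pnorm1.
by rewrite !exprS pnormM IH.
Qed.

Lemma pdistC x y : pnorm (x - y) = pnorm (y - x).
Proof. by rewrite -pnormN opprB. Qed.

Lemma pnormD_le x y e : pnorm x <= e -> pnorm y <= e -> pnorm (x + y) <= e.
Proof. by move=> xe ye; rewrite (le_trans (pnormD x y)) // ge_max xe. Qed.

Lemma pnormD_lt x y e : pnorm x < e -> pnorm y < e -> pnorm (x + y) < e.
Proof. by move=> xe ye; rewrite (le_lt_trans (pnormD x y)) // gt_max xe. Qed.

Lemma pdist_le_trans y x z e :
  pnorm (x - y) <= e -> pnorm (y - z) <= e -> pnorm (x - z) <= e.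
Proof. by move=> xy yz; rewrite -(subrKA y); apply: pnormD_le. Qed.

(** In an ultrametric triangle, the two longest sides are equal. *)
Lemma pnormD_eqr x y : pnorm x < pnorm y -> pnorm (x + y) = pnorm y.
Proof.
move=> xy; apply/eqP; rewrite eq_le pnormD_le ?(ltW xy) //=.
have := pnormD (x + y) (- x); rewrite pnormN addrC addKr le_max.
by rewrite [pnorm y <= pnorm x]leNgt xy orbF.
Qed.

Lemma pnormD_eql x y : pnorm y < pnorm x -> pnorm (x + y) = pnorm x.
Proof. by rewrite addrC; exact: pnormD_eqr. Qed.

Lemma pnormB_max x y :
  pnorm x != pnorm y -> pnorm (x - y) = Num.max (pnorm x) (pnorm y).
Proof.
case: ltgtP => // h _.
  by rewrite pnormD_eqr ?pnormN.
by rewrite pnormD_eql ?pnormN.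
Qed.

Lemma pnorm_exp x : x != 0 -> exists k : int, pnorm x = p%:R ^ k.
Proof.
move=> x0; have [u _ [c0 [N hN]]] := padic_stable x0.
have := hN N (leqnn N); rewrite /ratpnorm; case: eqP => [_ e|_ <-].
  by rewrite -e ltxx in c0.
by eexists.
Qed.

Lemma pnorm_int (n : int) : pnorm (n%:~R : padic p_pr) = ratpnorm p n%:~R.
Proof. by rewrite -[n%:~R in LHS](ratr_int _ n) pnorm_rat. Qed.

Lemma padic_intr_eq0 (n : int) : ((n%:~R : padic p_pr) == 0) = (n == 0).
Proof. by rewrite -pnorm_eq0 pnorm_int ratpnorm_eq0 // intr_eq0. Qed.

(** Integers embed into [Q_p], so fractions can be compared there by
    cross-multiplication. *)
Lemma ratr_addr1 (q : rat) : ratr (q + 1) = ratr q + 1 :> padic p_pr.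
Proof.
have int0 k : k != 0 -> (k%:~R : padic p_pr) != 0 by rewrite padic_intr_eq0.
have E : numq (q + 1) * denq q = (numq q + denq q) * denq (q + 1).
  apply: (@intr_inj rat); rewrite !intrM intrD !numqE; ring.
have /(congr1 (fun k => k%:~R : padic p_pr)) := E.
rewrite !intrM intrD => E'; rewrite /ratr.
have d0 := int0 _ (denq_neq0 q).
transitivity (((numq q)%:~R + (denq q)%:~R) / (denq q)%:~R : padic p_pr).
  2: by rewrite mulrDl divff.
by apply/eqP; rewrite eqr_div ?int0 ?denq_neq0 //; apply/eqP.
Qed.

End PadicNorm.

(** * Two-adic cancellation *)

Lemma ltr_exp2z (j k : int) : (2 ^ j < 2 ^ k :> rat) = (j < k)%R.
Proof. exact: ltr_eXz2l. Qed.

(** The value group of [Q_2] is discrete: consecutive radii differ by a factor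
    of 2. *)
Lemma exp2z_half (j k : int) :
  2 ^ j < 2 ^ k :> rat -> 2 ^ j <= 2 ^ k / 2 :> rat.
Proof.
rewrite ltr_exp2z => jk.
have -> : 2 ^ k / 2 = 2 ^ (k - 1) :> rat by rewrite expfzDr // exprN1.
by rewrite ler_eXz2l // lerBrDr -lezD1 in jk *.
Qed.

Section DyadicNorm.
Implicit Types x y : Q_2.

Lemma pnorm2 : pnorm (2 : Q_2) = 2^-1.
Proof.
have -> : 2 = ratr 2 :> Q_2 by rewrite ratr_nat.
rewrite pnorm_rat; have := @ratpnorm_frac 2 2 1 isT isT.
by rewrite divr1 => ->.
Qed.

Lemma two_neq0 : (2 : Q_2) != 0.
Proof. by rewrite -pnorm_eq0 pnorm2. Qed.

Lemma pnorm_lt_half x y : pnorm x < pnorm y -> pnorm x <= pnorm y / 2.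
Proof.
have [->|x0] := eqVneq x 0; first by rewrite pnorm0 divr_ge0 ?pnorm_ge0.
have [->|y0] := eqVneq y 0; first by rewrite pnorm0 ltNge pnorm_ge0.
have [j ->] := pnorm_exp x0; have [k ->] := pnorm_exp y0.
exact: exp2z_half.
Qed.

(** A rational of norm 1 is a quotient of two odd integers, and the sum of two
    odd integers is even. *)
Lemma ratpnorm2_unitD1 (q : rat) : ratpnorm 2 q = 1 -> ratpnorm 2 (q + 1) < 1.
Proof.
have [->|q0] := eqVneq q 0; first by rewrite ratpnorm0.
move=> nq; have := nq; rewrite {1}/ratpnorm (negbTE q0) => /eqP.
rewrite pexprz_eq1 // orbF subr_eq0 => /eqP [dn].
have n0 : (0 < `|numq q|)%N by rewrite absz_gt0 numq_eq0.
have d0 : (0 < `|denq q|)%N by rewrite absz_gt0 denq_neq0.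
have dodd : ~~ (2 %| `|denq q|)%N.
  apply/negP => d2; have n2 : (2 %| `|numq q|)%N.
    by move: d2; rewrite -[2%N]expn1 !pfactor_dvdn // dn.
  have := dvdn_gcd 2 `|numq q| `|denq q|.
  by rewrite n2 d2 (eqP (coprime_num_den q)).
have d1 : logn 2 `|denq q| = 0%N.
  by apply/eqP; rewrite lognE (negbTE dodd) !andbF.
have nodd : ~~ (2 %| `|numq q|)%N.
  by rewrite -[2%N]expn1 pfactor_dvdn // -dn d1.
have [->|q1] := eqVneq (q + 1) 0; first by rewrite ratpnorm0.
have E : q + 1 = (numq q + denq q)%:~R / (denq q)%:~R.
  by rewrite intrD mulrDl divq_num_den divff // intr_eq0 denq_neq0.
have nd0 : numq q + denq q != 0.
  by apply: contraNneq q1 => e; rewrite E e mul0r.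
have ndeven : (2 %| `|(numq q + denq q)%R|)%N by lia.
rewrite E ratpnorm_frac // ?denq_neq0 // d1 sub0r -[1](expr0z 2) ltr_exp2z.
by rewrite oppr_lt0 ltz_nat logn_gt0 mem_primes /= absz_gt0 nd0.
Qed.

(** The residue field of [Q_2] has two elements, so the leading terms of two
    numbers of the same norm cancel.  After division by [y] it suffices to
    treat [u + 1] with [|u| = 1], and then, by density, a rational [u]. *)
Lemma pnormD_half x y : pnorm x = pnorm y -> pnorm (x + y) <= pnorm x / 2.
Proof.
have [->|y0] := eqVneq y 0.
  rewrite pnorm0 => /eqP; rewrite pnorm_eq0 => /eqP ->.
  by rewrite addr0 pnorm0 mul0r.
move=> xy; rewrite xy; apply: pnorm_lt_half.
have yn0 : 0 < pnorm y by rewrite pnorm_gt0.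
have -> : x + y = (x / y + 1) * y by rewrite mulrDl divfK // mul1r.
rewrite pnormM gtr_pMl //.
have u1 : pnorm (x / y) = 1 by rewrite pnorm_div xy divff // gt_eqF.
have [q hq] := padic_dense (x / y) ltr01.
have qn : ratpnorm 2 q = 1.
  rewrite -(pnorm_rat prime2) -[ratr q](subrKC (x / y)) pnormD_eql u1 //.
  by rewrite pdistC.
have -> : x / y + 1 = (x / y - ratr q) + ratr (q + 1).
  by rewrite ratr_addr1 addrA subrK.
by apply: pnormD_lt => //; rewrite pnorm_rat ratpnorm2_unitD1.
Qed.

End DyadicNorm.
(** * Balls of a sphere *)

Section SphereSpace.
Variables (p : nat) (p_pr : prime p) (s : padic p_pr) (m : int).
Local Notation X := (psphere_space s m).

Definition spt (x : X) : padic p_pr := val (x : psphere_type s m).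

(** The balls of a sphere of radius [p ^ m] that stay inside it are those of
    radius at most [p ^ (m - 1)]; they are indexed by a level [j] so that level
    [0] is the largest one. *)
Definition sball (x : X) (j : nat) : set X :=
  [set y | pnorm (spt y - spt x) <= p%:R ^ (m - j.+1%:Z)].

Let p_gt1 : 1 < p%:R :> rat. Proof. by rewrite ltr1n prime_gt1. Qed.

Lemma spt_norm x : pnorm (spt x - s) = p%:R ^ m.
Proof. exact: set_mem (svalP x). Qed.

Lemma spt_inj : injective spt. Proof. exact: val_inj. Qed.

Lemma sball_refl x j : sball x j x.
Proof.
by rewrite /sball /= subrr pnorm0 exprz_ge0 // ltW // (lt_trans ltr01).
Qed.

Lemma sball_eq x y j : sball x j y -> sball x j = sball y j.
Proof.
rewrite /sball /= => xy; apply/seteqP; split => z /= h.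
  by apply: pdist_le_trans h _; rewrite pdistC.
exact: pdist_le_trans h xy.
Qed.

Lemma subset_sball x i j : (i <= j)%N -> sball x j `<=` sball x i.
Proof.
move=> ij y; rewrite /sball /= => /le_trans; apply.
by rewrite ler_eXz2l // lerD2l lerN2 lez_nat ltnS.
Qed.

Lemma psphere_ballsP (E : set X) :
  psphere_balls E <-> exists x j, E = sball x j.
Proof.
split=> [[t [k [tS ->]]]|[x [j ->]]].
  have p0 : 0 < p%:R :> rat by rewrite (lt_trans ltr01).
  have St : t \in psphere s (p%:R ^ m).
    by rewrite inE; apply: tS; rewrite /pball /= subrr pnorm0 exprz_ge0 // ltW.
  have km : (k < m)%R.
    (* otherwise the ball would contain the centre of the sphere *)
    rewrite ltNge; apply/negP => mk; have /tS : pball t (p%:R ^ k) s.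
      by move: St; rewrite inE /pball /= pdistC => ->; rewrite ler_eXz2l.
    by rewrite /psphere /= subrr pnorm0 => /eqP; rewrite lt_eqF // exprz_gt0.
  have [j ->] : exists j : nat, k = m - j.+1%:Z.
    by exists `|(m - k - 1)%R|%N; move: km; clear; lia.
  by exists (SigSub St : X), j.
exists (spt x), (m - j.+1%:Z); split => // y xy.
rewrite /psphere /= -(subrKA (spt x)) pnormD_eqr spt_norm //.
by apply: le_lt_trans xy _; rewrite ltr_eXz2l //; lia.
Qed.

Lemma measurable_sball x j : measurable (sball x j).
Proof. by apply: sub_gen_smallest; apply/psphere_ballsP; exists x, j. Qed.

Lemma haar_sball (R : realType) (mu : probability X R) x j :
  is_normalized_haar mu ->
  mu (sball x j) = (((p%:R - 1) * p%:R ^+ j)^-1)%:E.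
Proof.
move=> /(_ (spt x) (m - j.+1%:Z)) -> => [|y xy]; last first.
  rewrite /psphere /= -(subrKA (spt x)) pnormD_eqr spt_norm //.
  by apply: le_lt_trans xy _; rewrite ltr_eXz2l //; lia.
congr EFin; have p0 : p%:R != 0 :> rat by rewrite gt_eqF // (lt_trans ltr01).
have -> : p%:R * p%:R ^ (m - j.+1%:Z) / ((p%:R - 1) * p%:R ^ m) =
    ((p%:R - 1) * p%:R ^+ j)^-1 :> rat.
  rewrite expfzDr // -invr_expz -exprnP exprS; field.
  by rewrite p0 expfz_neq0 // expf_neq0 // subr_eq0 gt_eqF.
by rewrite fmorphV rmorphM rmorphB rmorph1 rmorphXn /= !ratr_nat.
Qed.

(** Two balls are nested or disjoint, so the balls together with the empty set
    and the whole sphere form a pi-system generating the sigma-algebra. *)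
Lemma psphere_measure_unique (R : realType)
    (m1 m2 : {measure set X -> \bar R}) :
  (m1 setT < +oo)%E -> m1 setT = m2 setT ->
  (forall x j, m1 (sball x j) = m2 (sball x j)) ->
  forall A, measurable A -> m1 A = m2 A.
Proof.
move=> m1oo m12T m12 A mA.
pose G := [set B : set X | B = set0 \/ B = setT \/ psphere_balls B].
apply: (@g_sigma_algebra_measure_unique _ _ _ G _ (fun=> setT)) => //.
- move=> B [->|[->|BG]]; [exact: measurable0|exact: measurableT|].
  exact: sub_gen_smallest.
- by move=> i; right; left.
- by rewrite bigcup_const.
- move=> B C [->|[->|BG]]; first by left; rewrite set0I.
    by rewrite setTI.
  move=> [->|[->|CG]]; first by left; rewrite setI0.
    by rewrite setIT; right; right.
  have [->|/set0P[z [Bz Cz]]] := eqVneq (B `&` C) set0; first by left.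
  right; right.
  have [x [i EB]] := (psphere_ballsP _).1 BG.
  have [y [j EC]] := (psphere_ballsP _).1 CG.
  rewrite EB in Bz BG *; rewrite EC in Cz CG *.
  rewrite (sball_eq Bz) (sball_eq Cz) in BG CG *.
  have [ij|ji] := leqP i j.
    by rewrite setIidr //; apply: subset_sball.
  by rewrite setIidl //; apply: subset_sball; exact: ltnW.
- move=> B [->|[->|/psphere_ballsP[x [j ->]]]]; rewrite ?measure0 //.
- move: mA; apply: sub_smallest2r; first exact: smallest_sigma_algebra.
  by move=> B BG; right; right.
Qed.

End SphereSpace.
(** * Adding machines on a 2-adic sphere *)

Section AddingMachine.
Variables (s : Q_2) (m : int).
Local Notation X := (psphere_space s m).
Local Notation rad j := ((2 : rat) ^ (m - j.+1%:Z)).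

Lemma radS (j : nat) : rad j.+1 = rad j / 2.
Proof.
have -> : m - j.+2%:Z = (m - j.+1%:Z) - 1 by lia.
by rewrite [LHS]expfzDr // exprN1.
Qed.

Lemma rad_gt0 (j : nat) : 0 < rad j. Proof. exact: exprz_gt0. Qed.

(** For [p = 2] the sphere is itself a ball. *)
Lemma sball0 (x : X) : sball x 0 = setT.
Proof.
apply/seteqP; split => // y _; rewrite /sball /=.
have -> : spt y - spt x = (spt y - s) + (s - spt x) by rewrite subrKA.
apply: le_trans (pnormD_half _) _; first by rewrite [RHS]pdistC !spt_norm.
by rewrite spt_norm [leRHS]expfzDr // exprN1.
Qed.

Lemma sballS_notin (x y : X) j :
  sball x j y -> ~ sball x j.+1 y -> pnorm (spt y - spt x) = rad j.
Proof.
rewrite /sball /= radS le_eqVlt => /orP[/eqP //|xy]; case.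
have [->|d0] := eqVneq (spt y - spt x) 0.
  by rewrite pnorm0 divr_ge0 // ltW ?rad_gt0.
move: xy; have [k ->] := pnorm_exp d0; exact: exp2z_half.
Qed.

(** [T_rigid] says that the displacement [T x - x] is Lipschitz with constant
    1/4; being smaller than 1, this constant makes [T] an isometry. *)
Variable T : X -> X.
Hypothesis T_rigid : forall x y,
  pnorm ((spt (T x) - spt (T y)) - (spt x - spt y)) <=
  pnorm (spt x - spt y) / 4.

(** Rigidity passes to the iterates with the same constant, because by
    ultrametricity the errors of successive steps do not add up. *)
Lemma iter_isometry_rigid n x y :
  pnorm (spt (iter n T x) - spt (iter n T y)) = pnorm (spt x - spt y) /\
  pnorm ((spt (iter n T x) - spt (iter n T y)) - (spt x - spt y))
    <= pnorm (spt x - spt y) / 4.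
Proof.
have iso u v : pnorm (spt (T u) - spt (T v)) = pnorm (spt u - spt v).
  have [->|uv] := eqVneq u v; first by rewrite !subrr.
  rewrite -[X in pnorm X = _](subrK (spt u - spt v)); apply: pnormD_eqr.
  apply: le_lt_trans (T_rigid u v) _.
  have : 0 < pnorm (spt u - spt v).
    by rewrite pnorm_gt0 subr_eq0; apply: contra_neq uv => /spt_inj.
  by lra.
elim: n => [|n [IH1 IH2]] /=.
  by rewrite subrr pnorm0 divr_ge0 ?pnorm_ge0.
split; first by rewrite iso.
by apply: pdist_le_trans IH2; rewrite -IH1.
Qed.

Lemma rigid_isometry x y :
  pnorm (spt (T x) - spt (T y)) = pnorm (spt x - spt y).
Proof. by have [] := iter_isometry_rigid 1 x y. Qed.

Hypothesis T_step : forall x, pnorm (spt (T x) - spt x) = rad 0%N.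

(** Let [N = 2 ^ k] and let [g] be the displacement of [T^N] at [x].  The
    displacement of [T^(2N)] at [x] is [g] plus the displacement of [T^N] at
    [T^N x], which is [g] up to an error of norm at most [|g| / 4]; so it is
    [2 g], of norm [|g| / 2], up to a smaller error. *)
Lemma iter_displacement k x :
  pnorm (spt (iter (2 ^ k) T x) - spt x) = rad k.
Proof.
elim: k x => [|k IH] x; first by rewrite expn0 /= T_step.
set N := (2 ^ k)%N; rewrite expnS mul2n -addnn iterD -/N.
set y := iter N T x; set g := spt y - spt x.
have gk : pnorm g = rad k by exact: IH.
have [_] := iter_isometry_rigid N y x; rewrite -/y -/g => err.
have -> : spt (iter N T y) - spt x = (spt (iter N T y) - spt y - g) + 2 * g.
  by rewrite /g; ring.
have g2 : pnorm (2 * g) = rad k.+1 by rewrite pnormM pnorm2 gk radS mulrC.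
rewrite pnormD_eqr g2 //; apply: le_lt_trans err _.
by rewrite gk radS; have := rad_gt0 k; lra.
Qed.

(** Both [y] and [T^(2^j) x] are at distance exactly [rad j] from [x], so by
    cancellation they are closer to each other: [T^(2^j)] exchanges the two
    halves of a ball of level [j]. *)
Lemma iter_exchange j (x y : X) :
  sball x j y -> ~ sball x j.+1 y -> sball (iter (2 ^ j) T x) j.+1 y.
Proof.
move=> xy nxy; have d := sballS_notin xy nxy.
rewrite /sball /= -(subrKA (spt x)) radS -d; apply: pnormD_half.
by rewrite [RHS]pdistC iter_displacement d.
Qed.

(** Once the orbit of [x] has entered the ball of level [j] of [y], it is in the
    right half of it, or [2 ^ j] more steps bring it there. *)
Lemma iter_transitive j (x y : X) : exists n, sball (iter n T x) j y.
Proof.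
elim: j => [|j [n xy]]; first by exists 0%N; rewrite sball0.
have [xy1|nxy] := pselect (sball (iter n T x) j.+1 y); first by exists n.
by exists (2 ^ j + n)%N; rewrite iterD; apply: iter_exchange.
Qed.

Lemma preimage_sball j (x y : X) :
  sball x j (T y) -> T @^-1` sball x j = sball y j.
Proof.
by move=> /sball_eq ->; apply/seteqP; split => z;
  rewrite /sball /= rigid_isometry.
Qed.

(** The orbit of [T x] gets close to [x], which provides a point of the ball in
    the range of [T]. *)
Lemma preimage_sball_ex j x : exists y, T @^-1` sball x j = sball y j.
Proof.
have [n] := iter_transitive j (T x) x; rewrite -iterSr /= => xn.
exists (iter n T x); apply: preimage_sball.
by rewrite -(sball_eq xn); apply: sball_refl.
Qed.

Lemma rigid_measurable : measurable_fun setT T.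
Proof.
apply: (measurability (@psphere_balls _ prime2 s m : set (set X))); first by [].
move=> _ [_ /psphere_ballsP[x [j ->]] <-]; rewrite setTI.
by have [y ->] := preimage_sball_ex j x; apply: measurable_sball.
Qed.

Variables (R : realType) (mu : probability X R).
Hypothesis mu_haar : is_normalized_haar mu.

Lemma rigid_measure_preserving : measure_preserving mu T.
Proof.
split => [|E mE]; first exact: rigid_measurable.
have nuT : pushforward mu T [set: X] = 1%E.
  by rewrite /pushforward preimage_setT probability_setT.
have nuoo : (pushforward mu T [set: X] < +oo)%E by rewrite nuT ltry.
transitivity (pushforward mu T E) => //.
apply: (@psphere_measure_unique _ _ _ _ _ (pushforward mu T) mu) => //.
- exact: rigid_measurable.
- move=> ? x j; have [y Exy] := preimage_sball_ex j x.
  transitivity (mu (sball y j)); first by rewrite -Exy.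
  exact: etrans (haar_sball y j mu_haar) (esym (haar_sball x j mu_haar)).
Qed.

(** For [E] invariant, [E] meets a ball and its image under [T] in the same
    measure, and the orbit of a ball covers all the balls of its level. *)
Lemma invariant_ball_measure (E : set X) (x y : X) j :
  measurable E -> T @^-1` E = E -> mu (E `&` sball x j) = mu (E `&` sball y j).
Proof.
move=> mE TE.
have step z : mu (E `&` sball (T z) j) = mu (E `&` sball z j).
  have [_ <-] := rigid_measure_preserving; last first.
    by apply: measurableI => //; apply: measurable_sball.
  by rewrite preimage_setI TE (@preimage_sball j (T z) z) //; apply: sball_refl.
have [n xy] := iter_transitive j x y; rewrite -(sball_eq xy).
elim: n {xy} => [//|n IH]; exact: etrans IH (esym (step _)).
Qed.

Lemma sball_split (x : X) j : exists y : X,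
  sball x j = sball x j.+1 `|` sball y j.+1 /\
  sball x j.+1 `&` sball y j.+1 = set0.
Proof.
exists (iter (2 ^ j) T x); have d := iter_displacement j x; split.
  apply/seteqP; split => z.
    move=> xz; have [?|nxz] := pselect (sball x j.+1 z); [by left|right].
    exact: iter_exchange.
  case; first exact: subset_sball.
  move/(subset_sball (leqnSn j)); rewrite -(@sball_eq _ _ _ _ x) //.
  by rewrite /sball /= d.
rewrite -subset0 => z [xz yz].
have : pnorm (spt (iter (2 ^ j) T x) - spt x) <= rad j.+1.
  by apply: pdist_le_trans xz; rewrite pdistC.
by rewrite d radS; have := rad_gt0 j; lra.
Qed.

(** By induction on the level: the two halves of a ball share equally both its
    measure and the measure of its intersection with [E]. *)
Lemma invariant_equidistributed (E : set X) (x : X) j :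
  measurable E -> T @^-1` E = E ->
  mu (E `&` sball x j) = (mu E * mu (sball x j))%E.
Proof.
move=> mE TE; rewrite haar_sball // -[mu E]fineK ?fin_num_measure //.
rewrite -[LHS]fineK ?fin_num_measure //; last first.
  by apply: measurableI => //; apply: measurable_sball.
rewrite -EFinM; congr EFin; rewrite addrK mul1r.
elim: j x => [|j IH] x; first by rewrite sball0 setIT expr0 invr1 mulr1.
have [y [U D]] := sball_split x j.
have mEB z : measurable (E `&` sball z j.+1).
  by apply: measurableI => //; apply: measurable_sball.
have split_mu : mu (E `&` sball x j) =
    (mu (E `&` sball x j.+1) + mu (E `&` sball y j.+1))%E.
  by rewrite U setIUr measureU // setIACA D setI0.
have := IH x; rewrite split_mu (invariant_ball_measure y x) //.
rewrite fineD ?fin_num_measure // exprS invfM => h; lra.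
Qed.

Theorem adding_machine_ergodic : ergodic mu T.
Proof.
split; first exact: rigid_measure_preserving.
move=> E mE TE; pose e := fine (mu E).
have muE : mu E = e%:E by rewrite fineK ?fin_num_measure.
have e0 : 0 <= e by rewrite fine_ge0.
have prod A : measurable A -> mu (A `&` E) = (e%:E * mu A)%E.
  move=> mA; pose m1 := mrestr mu mE; pose m2 := mscale (NngNum e0) mu.
  apply: (@psphere_measure_unique _ _ _ _ _ m1 m2) => //=.
  - by rewrite /m1 /mrestr setTI muE ltry.
  - by rewrite /m1 /mrestr setTI /m2 /mscale /= probability_setT mule1.
  - move=> x j; rewrite /m1 /mrestr /m2 /mscale /= setIC.
    by rewrite invariant_equidistributed // muE.
have := prod E mE; rewrite setIid muE -EFinM => -[ee].
have : e * (e - 1) = 0 by rewrite mulrBr mulr1 -ee subrr.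
move/eqP; rewrite mulf_eq0 subr_eq0 => /orP[] /eqP ->; [by left|by right].
Qed.

End AddingMachine.

(** * Maps with small steps *)

(** Balls of level 1 are invariant: a point and its image always lie in the same
    one.  Their measure [1 / ((p - 1) p)] is neither 0 nor 1. *)
Lemma small_step_not_ergodic (p : nat) (p_pr : prime p) (s : padic p_pr)
    (m : int) (R : realType) (mu : probability (psphere_space s m) R)
    (T : psphere_space s m -> psphere_space s m) :
  is_normalized_haar mu ->
  (forall x, pnorm (spt (T x) - spt x) <= p%:R ^ (m - 2)) -> ~ ergodic mu T.
Proof.
move=> mu_haar step [_ erg]; pose E := sball (point : psphere_space s m) 1.
have TE : T @^-1` E = E.
  apply/seteqP; split => x; rewrite /E /sball /= => h.
    by apply: pdist_le_trans h; rewrite pdistC.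
  exact: pdist_le_trans (step x) h.
have p2 : 2 <= p%:R :> R by rewrite ler_nat prime_gt1.
have muE := haar_sball point 1 mu_haar.
have den2 : 2 <= (p%:R - 1) * p%:R ^+ 1 :> R by rewrite expr1; nra.
have [] := erg E (measurable_sball _ _) TE; rewrite /E muE => -[/eqP].
  by rewrite invr_eq0 => /eqP e; move: den2; rewrite e; lra.
by rewrite invr_eq1 => /eqP e; move: den2; rewrite e; lra.
Qed.

(** * The rational map *)

Lemma rational_map_sub_id (F : fieldType) (a c x : F) :
  x ^+ 2 + c * x + a != 0 ->
  a * x / (x ^+ 2 + c * x + a) - x =
  - (x ^+ 2 * (c + x)) / (x ^+ 2 + c * x + a).
Proof. by move=> q0; field. Qed.

Lemma rational_map_sub (F : fieldType) (a c x y : F) :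
  x ^+ 2 + c * x + a != 0 -> y ^+ 2 + c * y + a != 0 ->
  (a * x / (x ^+ 2 + c * x + a) - a * y / (y ^+ 2 + c * y + a)) - (x - y) =
  (x - y) * - (a * (x * y) + a * (c * (x + y)) + a * (x ^+ 2 + y ^+ 2)
             + (c * x + x ^+ 2) * (c * y + y ^+ 2)) /
  ((x ^+ 2 + c * x + a) * (y ^+ 2 + c * y + a)).
Proof. by move=> qx0 qy0; field; rewrite qx0 qy0. Qed.

Section RationalMap.
Variables (p : nat) (p_pr : prime p) (x1 x2 : padic p_pr).
Local Notation a := (x1 * x2).
Local Notation c := (- (x1 + x2)).
Local Notation q x := (x ^+ 2 + c * x + a).
Local Notation f := (fun x : padic p_pr => a * x / q x).

Lemma denominator_factor (x : padic p_pr) : q x = (x - x1) * (x - x2).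
Proof. by ring. Qed.

(** A sphere through a pole is not invariant.  Otherwise [|x - xi|] is the
    maximum of [r] and [|xi|], and [|f x| = r] amounts to
    [max r |x1| * max r |x2| = |x1| * |x2|]. *)
Lemma invariant_radius_lt (m : int) : a != 0 ->
  invariant_set [set x | x <> x1 /\ x <> x2] f (psphere 0 (p%:R ^ m)) ->
  p%:R ^ m < Num.min (pnorm x1) (pnorm x2).
Proof.
move=> a0 hinv; set r := _ ^ m in hinv *.
have r0 : 0 < r by rewrite exprz_gt0 // ltr0n prime_gt0.
have [x10 x20] : 0 < pnorm x1 /\ 0 < pnorm x2.
  by apply/andP; rewrite !pnorm_gt0 -negb_or -mulf_eq0.
have [x1r x2r] : r != pnorm x1 /\ r != pnorm x2.
  split; apply/eqP => xr.
    have [|/(_ 0%N isT)[/= nx _] _] := hinv x1 _ 1%N isT; last exact: nx.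
    by rewrite /psphere /= subr0.
  have [|/(_ 0%N isT)[/= _ nx] _] := hinv x2 _ 1%N isT; last exact: nx.
  by rewrite /psphere /= subr0.
have := psphere_nonempty (0 : padic p_pr) m; rewrite inE; set x := _ + _.
rewrite /psphere /= subr0 -/r => xr.
have [|_] := hinv x _ 1%N isT; first by rewrite /psphere /= subr0.
rewrite /psphere /= subr0 -/r denominator_factor pnorm_div !pnormM xr.
rewrite !pnormB_max xr //.
set u := pnorm x1 in x10 x1r *; set v := pnorm x2 in x20 x2r *.
set M := Num.max r u; set N := Num.max r v => e.
have [rM uM] : r <= M /\ u <= M by rewrite !le_max !lexx orbT.
have [rN vN] : r <= N /\ v <= N by rewrite !le_max !lexx orbT.
have MN : M * N = u * v.
  have M0 : M != 0 by rewrite gt_eqF // (lt_le_trans r0).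
  have N0 : N != 0 by rewrite gt_eqF // (lt_le_trans r0).
  apply: (mulfI (lt0r_neq0 r0)); rewrite -[X in X * (M * N)]e.
  by rewrite divfK ?mulf_neq0 // mulrC.
rewrite lt_min !lt_neqAle x1r x2r !leNgt /=.
by apply/andP; split; apply/negP => h; nra.
Qed.

Lemma denominator_norm (x : padic p_pr) :
  pnorm x < pnorm x1 -> pnorm x < pnorm x2 -> pnorm (q x) = pnorm a.
Proof.
move=> h1 h2; rewrite denominator_factor !pnormM.
by rewrite !pnormD_eqr ?pnormN.
Qed.

Lemma map_step_norm (x : padic p_pr) : a != 0 ->
  pnorm x < pnorm x1 -> pnorm x < pnorm x2 ->
  pnorm (f x - x) = pnorm x ^+ 2 * pnorm (c + x) / pnorm a.
Proof.
move=> a0 h1 h2; have qa := denominator_norm h1 h2.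
have q0 : q x != 0 by rewrite -pnorm_eq0 qa pnorm_eq0.
by rewrite rational_map_sub_id // pnorm_div qa pnormN (pnormM (x ^+ 2)) pnormX.
Qed.

End RationalMap.

Section DyadicMap.
Variables (x1 x2 : Q_2).
Local Notation a := (x1 * x2).
Local Notation c := (- (x1 + x2)).
Local Notation q x := (x ^+ 2 + c * x + a).
Local Notation f := (fun x : Q_2 => a * x / q x).

(** Each term of the numerator in [rational_map_sub] has norm at most
    [|a|^2 / 4], while both denominators have norm [|a|].  The term
    [a c (x + y)] owes one of its factors 1/2 to the cancellation in [x + y]. *)
Lemma map_rigid (r : rat) (x y : Q_2) : a != 0 ->
  r < pnorm x1 -> r < pnorm x2 ->
  4 * r ^+ 2 <= pnorm a -> 2 * (pnorm c * r) <= pnorm a ->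
  pnorm x = r -> pnorm y = r ->
  pnorm ((f x - f y) - (x - y)) <= pnorm (x - y) / 4.
Proof.
move=> a0 rx1 rx2 ar ac xr yr.
have qx : pnorm (q x) = pnorm a by rewrite denominator_norm ?xr.
have qy : pnorm (q y) = pnorm a by rewrite denominator_norm ?yr.
have qx0 : q x != 0 by rewrite -pnorm_eq0 qx pnorm_eq0.
have qy0 : q y != 0 by rewrite -pnorm_eq0 qy pnorm_eq0.
rewrite rational_map_sub //; set w := - (_ + _ : Q_2).
rewrite pnorm_div (pnormM (x - y)) (pnormM (q x)) qx qy -mulrA.
apply: ler_wpM2l; first exact: pnorm_ge0.
have aM z : pnorm (a * z) = pnorm a * pnorm z by exact: pnormM.
have cM z : pnorm (c * z) = pnorm c * pnorm z by exact: pnormM.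
have A0 : 0 < pnorm a by rewrite pnorm_gt0.
have C0 : 0 <= pnorm c by exact: pnorm_ge0.
move: (pnorm a) (pnorm c) A0 C0 ar ac aM cM => A C A0 C0 ar ac aM cM.
rewrite ler_pdivrMr ?mulr_gt0 // /w pnormN.
have r0 : 0 <= r by rewrite -xr pnorm_ge0.
have half z : pnorm z = r -> pnorm (c * z + z ^+ 2) <= A / 2.
  by move=> zr; apply: pnormD_le; rewrite ?cM ?pnormX zr; lra.
apply: pnormD_le; first apply: pnormD_le; first apply: pnormD_le.
- by rewrite aM pnormM xr yr; nra.
- have := @pnormD_half x y; rewrite xr yr => /(_ erefl) h.
  rewrite aM cM.
  have : C * pnorm (x + y) <= C * (r / 2) by rewrite ler_wpM2l.
  by nra.
- have : pnorm (x ^+ 2 + y ^+ 2) <= r ^+ 2.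
    by apply: pnormD_le; rewrite pnormX ?xr ?yr.
  by rewrite aM; nra.
- rewrite pnormM; have := half _ xr; have := half _ yr.
  move: (pnorm_ge0 (c * x + x ^+ 2)) (pnorm_ge0 (c * y + y ^+ 2)).
  by nra.
Qed.

End DyadicMap.

Lemma quadratic_roots (F : fieldType) (a c d : F) : 2 != 0 :> F ->
  d ^+ 2 = c ^+ 2 - 4 * a ->
  a = (- c + d) / 2 * ((- c - d) / 2) /\ c = - ((- c + d) / 2 + (- c - d) / 2).
Proof.
move=> two0 hd; split; last by field.
have four0 : 4 != 0 :> F by rewrite (natrM _ 2 2) mulf_neq0.
have -> : (- c + d) / 2 * ((- c - d) / 2) = (c ^+ 2 - d ^+ 2) / 4.
  by field; rewrite ?two0 ?four0.
by rewrite hd; field; rewrite ?two0 ?four0.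
Qed.

Theorem rational_map_ergodicP (R : realType) (x1 x2 : Q_2) (m : int)
    (hinv : invariant_set [set x | x <> x1 /\ x <> x2]
       (fun x => x1 * x2 * x / (x ^+ 2 + - (x1 + x2) * x + x1 * x2))
       (psphere (0 : Q_2) (2 ^ m)))
    (mu : probability (psphere_space (0 : Q_2) m) R) :
  x1 * x2 != 0 -> is_normalized_haar mu ->
  ergodic mu (psphere_map hinv) <->
  pnorm (- (x1 + x2)) = Num.max (pnorm x1) (pnorm x2) /\
  2 ^ m = Num.min (pnorm x1) (pnorm x2) / 2.
Proof.
move=> a0 mu_haar; set r : rat := 2 ^ m.
have r0 : 0 < r by rewrite exprz_gt0.
have r_lt : r < Num.min (pnorm x1) (pnorm x2) := invariant_radius_lt a0 hinv.
have : exists k : int, Num.min (pnorm x1) (pnorm x2) = 2 ^ k.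
  have [x10 x20] : x1 != 0 /\ x2 != 0 by apply/andP; rewrite -negb_or -mulf_eq0.
  have [k1 e1] := pnorm_exp x10; have [k2 e2] := pnorm_exp x20.
  by rewrite /Num.min; case: ifP => _; [exists k1|exists k2].
have ab : Num.min (pnorm x1) (pnorm x2) * Num.max (pnorm x1) (pnorm x2) =
    pnorm (x1 * x2).
  by rewrite pnormM /Num.min /Num.max; case: ifP => // _; rewrite mulrC.
have le_ab : Num.min (pnorm x1) (pnorm x2) <= Num.max (pnorm x1) (pnorm x2).
  by rewrite ge_min !le_max lexx.
have [rx1 rx2] : r < pnorm x1 /\ r < pnorm x2.
  by apply/andP; rewrite -lt_min.
have norm_pt x : pnorm (@spt _ _ (0 : Q_2) m x) = r.
  by have := spt_norm x; rewrite subr0.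
have step x : pnorm (spt (psphere_map hinv x) - spt x) =
    r ^+ 2 * pnorm (- (x1 + x2) + spt x) / pnorm (x1 * x2).
  by rewrite -(norm_pt x); apply: map_step_norm; rewrite ?norm_pt.
have c_le : pnorm (- (x1 + x2)) <= Num.max (pnorm x1) (pnorm x2).
  by rewrite pnormN pnormD.
have c_eq : pnorm x1 = pnorm x2 ->
    pnorm (- (x1 + x2)) <= Num.min (pnorm x1) (pnorm x2) / 2.
  by move=> e; rewrite pnormN -e minxx; apply: pnormD_half.
have c_ne : pnorm x1 <> pnorm x2 ->
    pnorm (- (x1 + x2)) = Num.max (pnorm x1) (pnorm x2).
  move=> /eqP ne; rewrite -[x2 in LHS]opprK pnormN pnormB_max pnormN //.
have eq_max : pnorm x1 = pnorm x2 ->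
    Num.max (pnorm x1) (pnorm x2) = Num.min (pnorm x1) (pnorm x2).
  by move=> ->; rewrite maxxx minxx.
move: (Num.min _ _) (Num.max _ _) r_lt ab le_ab c_le c_eq c_ne eq_max
  => al be r_lt ab le_ab c_le c_eq c_ne eq_max [k alk].
have rk : r <= al / 2 by rewrite alk; apply: exp2z_half; rewrite -alk.
split=> [erg|[cbe ral]].
  (* If every step were at most [r / 4], balls would be invariant. *)
  have [x big] : exists x, r / 4 < pnorm (spt (psphere_map hinv x) - spt x).
    apply/not_existsP => small; apply: (small_step_not_ergodic mu_haar _ erg).
    move=> x; have -> : 2 ^ (m - 2) = r / 4 :> rat by rewrite expfzDr.
    by rewrite leNgt; apply/negP.
  have far : al * be < 4 * (r * pnorm (- (x1 + x2) + spt x)).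
    have ab0 : 0 < al * be by nra.
    move: big; rewrite step -ab ltr_pdivlMr //.
    have := pnorm_ge0 (- (x1 + x2) + spt x).
    by nra.
  (* Equal norms of the poles make [c], hence the step, too small. *)
  have x12 : pnorm x1 <> pnorm x2.
    move=> e; have : pnorm (- (x1 + x2) + spt x) <= al / 2.
      by apply: pnormD_le; rewrite ?norm_pt ?c_eq.
    by have := eq_max e; nra.
  split; first exact: c_ne.
  have : pnorm (- (x1 + x2) + spt x) <= be.
    by apply: pnormD_le; rewrite ?norm_pt; lra.
  (* The step bound gives [r > al / 4], and [r <= al / 2] holds already. *)
  move=> cx; apply/eqP; rewrite eq_le rk /= leNgt; apply/negP => small.
  have : r <= al / 2 / 2.
    have E : al / 2 = 2 ^ (k - 1) by rewrite alk expfzDr // exprN1.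
    by rewrite E; apply: exp2z_half; rewrite -E.
  by nra.
have cnorm x : pnorm (- (x1 + x2) + @spt _ _ (0 : Q_2) m x) = be.
  by rewrite pnormD_eql // norm_pt cbe; lra.
apply: adding_machine_ergodic => // [x y|x].
  apply: (@map_rigid x1 x2 r); rewrite ?norm_pt //; rewrite -ab ?cbe; nra.
rewrite step cnorm -ab; have -> : 2 ^ (m - 1%:Z) = r / 2 :> rat.
  by rewrite expfzDr // exprN1.
by rewrite ral; field; rewrite !gt_eqF; lra.
Qed.

Theorem theorem6 (R : realType) (a c d : Q_2) (hac : a * c != 0)
    (hd : d ^+ 2 = c ^+ 2 - 4 * a) (m : int) :
  let x1 : Q_2 := (- c + d) / 2 in
  let x2 : Q_2 := (- c - d) / 2 in
  let f : Q_2 -> Q_2 := fun x => a * x / (x ^+ 2 + c * x + a) in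
  let D : set Q_2 := [set x | x <> x1 /\ x <> x2] in
  let alpha : rat := Num.min (pnorm x1) (pnorm x2) in
  let beta : rat := Num.max (pnorm x1) (pnorm x2) in
  let r : rat := 2 ^ m in
  forall (hinv : invariant_set D f (psphere (0 : Q_2) r))
    (mu : probability (psphere_space (0 : Q_2) m) R),
  is_normalized_haar mu ->
  ergodic mu (psphere_map hinv) <-> pnorm c = beta /\ r = alpha / 2.
Proof.
have a0 : a != 0 by apply: contraNneq hac => ->; rewrite mul0r.
have [] := quadratic_roots two_neq0 hd.
move: (_ / 2) (_ / 2) => x1 x2 /= Ea Ec; clear hd hac; subst a c.
by move=> hinv mu mu_haar; apply: rational_map_ergodicP.
Qed.
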